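(* If a topological space $X$ is c.c.c. and $\omega_1\le\Delta(X)\le|X|<\omega_\omega$, then $X$ is monotonically $\omega_1$-resolvable.
   Context: $\Delta(X)=\min\{|G|: G\ne\emptyset \text{ open in } X\}$. A space is c.c.c. if every family of pairwise disjoint non-empty open sets is countable. A topological space $X$ is monotonically $\omega_1$-resolvable if there is a function $f:X\to\omega_1$ such that $\{x\in X: f(x)\ge\alpha\}$ is dense in $X$ for each $\alpha<\omega_1$. *)

(* Defs.v *)
From mathcomp Require Import all_boot all_classical topology.
From mathcomp Require wochoice.

Set Implicit Arguments.
Unset Strict Implicit.
Unset Printing Implicit Defensive.

Local Open Scope classical_set_scope.
Local Open Scope card_scope.

Definition card_lt (T U : Type) (A : set T) (B : set U) : Prop :=
  A #<= B /\ ~ (A #= B).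

Definition wo_le (T : eqType) : rel T := sval (wochoice.well_ordering_principle T).

Definition initial_segment (T : eqType) (R : rel T) (x : T) : set T :=
  [set y | R y x && (y != x)].

(* [omega n] is the initial ordinal omega_n.  An ordinal is represented by its
   position in a sufficiently long well-order: omega_{n+1} is the set of the
   ordinals of cardinality at most |omega_n|, and the well-order on the power
   set of omega_n is long enough to contain all of them, by Cantor's theorem.
   See [omega_wo], [omegaS_segment] and [omegaS_gt]. *)
Fixpoint omega (n : nat) : choiceType :=
  if n is m.+1 then
    set_type [set x : set (omega m) |
                initial_segment (@wo_le (set (omega m))) x #<= [set: omega m]]
  else nat.

Definition omega_le (n : nat) : rel (omega n) :=
  match n return rel (omega n) with
  | 0 => leq
  | m.+1 => fun x y => wo_le (val x) (val y)
  end.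

(* The initial ordinal omega_omega = sup_n omega_n, i.e. the set of the
   ordinals of cardinality at most |omega_n| for some n.  Only its cardinality
   matters here; see [card_lt_omega_omegaP]. *)
Definition omega_omega : choiceType :=
  set_type [set x : set {n : nat & omega n} |
              exists n, initial_segment (@wo_le (set {n : nat & omega n})) x
                        #<= [set: omega n]].

(* The cardinal Delta(X) is represented by a non-empty open set of minimal
   cardinality; see [DeltaP]. *)
Definition Delta (X : topologicalType) : set X :=
  xget set0 [set G | [/\ open G, G !=set0 &
    forall H : set X, open H -> H !=set0 -> G #<= H]].
Arguments Delta X : clear implicits.

Definition ccc (X : topologicalType) : Prop :=
  forall F : set (set X), (forall U, F U -> open U /\ U !=set0) ->
    trivIset F id -> countable F.

Definition monotonically_omega1_resolvable (X : topologicalType) : Prop :=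
  exists f : X -> omega 1,
    forall a : omega 1, dense [set x | omega_le a (f x)].

Section Cardinals.

Lemma injT_card_le (T U : Type) (A : set T) (B : set U) (f : T -> U) :
  (forall x, A x -> B (f x)) ->
  (forall x y, A x -> A y -> f x = f y -> x = y) -> A #<= B.
Proof.
move=> fAB fI; have [|g] := (@injfunPex T U A B).2; last exact: inj_card_le.
by exists f => // x y /set_mem Ax /set_mem Ay; apply: fI.
Qed.

Lemma min_card (I : Type) (U : I -> Type) (i0 : I) :
  exists i, forall j, [set: U i] #<= [set: U j].
Proof.
pose P := [set S : set (forall i, U i) |
  forall f g, S f -> S g -> forall i, f i = g i -> f = g].
have [F FP Ftot|A [PA maxA]] := @Zorn_bigcup _ P.
  move=> f g [S FS Sf] [S' FS' S'g]; have [SS'|S'S] := Ftot _ _ FS FS'.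
    by apply: (FP _ FS') => //; apply: SS'.
  by apply: (FP _ FS) => //; apply: S'S.
have [[i /choice[g Ag]]|noi] :=
    pselect (exists i, forall u, exists f, A f /\ f i = u).
  exists i => j; apply: (@injT_card_le _ _ _ _ (fun u => g u j)) => // u v _ _ e.
  have [Au <-] := Ag u; have [Av <-] := Ag v.
  by rewrite (PA _ _ Au Av _ e).
have /all_sig[a aP] i : {u | forall f, A f -> f i <> u}.
  apply/cid; apply: contrapT => nu; apply: noi; exists i => u.
  apply: contrapT => nf; apply: nu; exists u => f Af fu.
  by apply: nf; exists f.
have aNA : ~ A a by move=> Aa; exact: (aP i0 _ Aa).
exfalso; apply: (maxA (A `|` [set a])).
  by split=> [f Af|sub]; [left|apply/aNA/sub; right].
move=> f g [Af|->] [Ag|->] i // e; first exact: (PA _ _ Af Ag i).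
  by case: (aP i _ Af).
by case: (aP i _ Ag).
Qed.

Lemma card_le_total (T U : Type) (A : set T) (B : set U) :
  A #<= B \/ B #<= A.
Proof.
have [b bP] := @min_card bool
  (fun b => if b then set_type A else set_type B) true.
case: b bP => [/(_ false)|/(_ true)] /= le; [left|right].
  by rewrite -(card_le_eql (card_setT A)) -(card_le_eqr (card_setT B)).
by rewrite -(card_le_eql (card_setT B)) -(card_le_eqr (card_setT A)).
Qed.

Lemma card_le_inj (T U : Type) (A : set T) (B : set U) : A #<= B ->
  exists f : A -> B, injective f.
Proof.
move=> /card_leP[f]; exists f => x y.
by apply: (@inj _ _ [set: A] f); rewrite inE.
Qed.

Lemma Cantor (T : Type) : ~ ([set: set T] #<= [set: T]).
Proof.
move=> /card_le_inj[f fI].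
pose g (A : set T) : T := val (f (SigSub (mem_set (I : [set: set T] A)))).
have gI A B : g A = g B -> A = B by move=> /val_inj /fI /(congr1 val).
pose D := [set g A | A in [set A | ~ A (g A)]].
have DD : ~ D (g D).
  by move=> [A AN] /[dup] gAD /gI AD; apply: (AN); rewrite {1}AD gAD -gAD; exists A.
by apply: (DD); exists D.
Qed.

End Cardinals.

Section WellOrder.
Variable T : eqType.
Implicit Types (x y z : T) (S : set T).

Lemma wo_leP : wochoice.well_order (@wo_le T).
Proof. exact: svalP. Qed.

Lemma wo_le_total x y : wo_le x y || wo_le y x.
Proof.
have [|z [[zP zmin] _]] := wo_leP (A := pred2 x y).
  by exists x; rewrite inE eqxx.
have zx : wo_le z x by apply: zmin; rewrite inE eqxx.
have zy : wo_le z y by apply: zmin; rewrite inE eqxx orbT.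
by case/pred2P: zP zx zy => -> => [_ ->|-> _] //; rewrite orbT.
Qed.

Lemma wo_le_anti x y : wo_le x y -> wo_le y x -> x = y.
Proof.
move=> xy yx; have refl z : wo_le z z by have := wo_le_total z z; rewrite orbb.
have [|z [_ zu]] := wo_leP (A := pred2 x y); first by exists x; rewrite inE eqxx.
have <- : z = x.
  by apply: zu; split=> [|w /pred2P[]->//]; rewrite inE eqxx.
by apply: zu; split=> [|w /pred2P[]->//]; rewrite inE eqxx orbT.
Qed.

Lemma wo_min S : S !=set0 ->
  exists2 z, S z & forall y, S y -> wo_le z y.
Proof.
move=> [x Sx]; have [|z [[zS zmin] _]] := wo_leP (A := fun x => `[< S x >]).
  by exists x; apply/asboolP.
by exists z => [|y Sy]; [exact/asboolP|apply: zmin; exact/asboolP].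
Qed.

Lemma not_segment x y : ~ initial_segment (@wo_le T) x y -> wo_le x y.
Proof.
move=> nyx; case/orP: (wo_le_total x y) => // yx.
have [yE|yNx] := eqVneq y x; first by rewrite yE in yx *.
by case: nyx; apply/andP.
Qed.

Lemma segment_wf : well_founded (fun y x => initial_segment (@wo_le T) x y).
Proof.
move=> x; apply: contrapT => nx.
have [z nz zmin] := @wo_min [set x | ~ Acc _ x] (ex_intro _ x nx).
apply: nz; constructor => y /andP[yz ynz]; apply: contrapT => ny.
by move/eqP: ynz; apply; apply: wo_le_anti (zmin _ ny).
Qed.

Lemma card_le_segments (U : Type) (S : set T) (A : set U) :
  (forall x, S x -> ~ (A #<= initial_segment (@wo_le T) x)) -> S #<= A.
Proof.
move=> ltA; pose lt y x := initial_segment (@wo_le T) x y.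
pose new x (h : forall y, lt y x -> option U) a :=
  A a /\ forall y yx, h y yx <> Some a.
pose F x h := if pselect (exists a, new x h a) is left e
              then Some (sval (cid e)) else None.
pose g := Fix segment_wf (fun=> option U) F.
have gE x : g x = F x (fun y _ => g y).
  apply: Fix_eq => {}x h h' hh'; congr F.
  by apply: functional_extensionality_dep => y;
     apply: functional_extensionality_dep => yx.
have gP x : S x -> exists a, g x = Some a /\ new x (fun y _ => g y) a.
  move=> Sx; rewrite gE /F; case: pselect => [e|none].
    by exists (sval (cid e)); split=> //; apply: svalP.
  exfalso; apply: (ltA x Sx).
  have pre a : exists y, A a -> lt y x /\ g y = Some a.
    have [Aa|] := pselect (A a); last by exists x.
    apply: contrapT => ny; apply: none; exists a; split=> // y yx gy.
    by apply: ny; exists y.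
  have [p pP] := choice pre.
  apply: (injT_card_le (f := p)) => [a /pP[]//|a b /pP[_ ga] /pP[_ gb] e].
  by move: ga; rewrite e gb => -[].
have ltP x y : S y -> lt x y -> g x <> g y.
  by move=> /gP[a [-> [_ aN]]] xy; apply: aN.
have /choice[f fP] (x : S) : exists a, g (val x) = Some a /\ A a.
  by have [a [ga [Aa _]]] := gP _ (set_valP x); exists a.
rewrite -(card_le_eql (card_setT S)).
apply: (injT_card_le (f := f)) => [x _|x y _ _ fxy]; first exact: (fP x).2.
have gxy : g (val x) = g (val y) by rewrite (fP x).1 (fP y).1 fxy.
have nlt (u v : S) : g (val u) = g (val v) -> wo_le (val v) (val u).
  move=> guv; apply: not_segment => uv.
  exact: (ltP _ _ (set_valP v) uv guv).
by apply/val_inj/wo_le_anti; apply: nlt.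
Qed.

End WellOrder.

Lemma short_gt (T : eqType) (U : Type) : [set: U] #<= [set: T] ->
  ~ ([set x : set T | initial_segment (@wo_le (set T)) x #<= [set: U]]
     #<= [set: U]).
Proof.
move=> UT; set S := [set x | _] => SU.
have [ST|/existsNP nS] := pselect (forall x, S x).
  apply: (@Cantor T); apply: card_le_trans UT; apply: card_le_trans SU.
  by apply: subset_card_le => x _; apply: ST.
have [x nSx xmin] := @wo_min _ [set x | ~ S x] nS.
apply: nSx; apply: card_le_trans SU; apply: subset_card_le => y /andP[yx ynx].
apply: contrapT => /xmin xy; move/eqP: ynx; apply; exact: wo_le_anti.
Qed.

Section Omega.

Lemma omega_wo n : wochoice.well_order (@omega_le n).
Proof.
have [anti min] : antisymmetric (@omega_le n) /\
    forall S : set (omega n), S !=set0 ->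
      exists2 z, S z & forall y, S y -> omega_le z y.
  case: n => [|n] /=; split.
  - exact: anti_leq.
  - move=> S [x Sx]; have ex : exists m, `[< S m >] by exists x; apply/asboolP.
    case: (ex_minnP ex) => z /asboolP Sz zmin.
    by exists z => // y Sy; apply: zmin; apply/asboolP.
  - by move=> x y /andP[xy yx]; apply/val_inj/wo_le_anti.
  - move=> S [x Sx].
    have [|z [u Su <-] zmin] := @wo_min _ (val @` S); first by exists (val x), x.
    by exists u => // y Sy; apply: zmin; exists y.
apply: wochoice.antisymmetric_well_order => // A [x Ax].
have [|z zA zmin] := min [set` A]; first by exists x.
by exists z; split => // y /zmin.
Qed.

Lemma omegaS_segment n (x : omega n.+1) :
  initial_segment (@omega_le n.+1) x #<= [set: omega n].
Proof.
apply: card_le_trans (set_valP x).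
apply: (injT_card_le (f := val)) => [y|y z _ _ /val_inj//].
by rewrite /initial_segment/= (inj_eq val_inj).
Qed.

Lemma omegaS_gt n : ~ ([set: omega n.+1] #<= [set: omega n]).
Proof. by rewrite (card_le_eql (card_setT _)); apply: short_gt. Qed.

Lemma omega_leS n : [set: omega n] #<= [set: omega n.+1].
Proof. by case: (card_le_total [set: omega n] [set: omega n.+1]) => // /omegaS_gt. Qed.

Lemma omega_lt_omega_omega n : ~ ([set: omega_omega] #<= [set: omega n]).
Proof.
rewrite (card_le_eql (card_setT _)) => le.
apply: (@short_gt {n & omega n} (omega n)).
  apply: (injT_card_le (f := @Tagged _ n omega)) => // x y _ _.
  exact: eq_from_Tagged.
apply: card_le_trans le; apply: subset_card_le => x xn; by exists n.
Qed.

Lemma card_lt_omega_omegaP (U : Type) (A : set U) :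
  card_lt A [set: omega_omega] <-> exists n, A #<= [set: omega n].
Proof.
split=> [[le ne]|[n An]].
  apply: contrapT => nA; apply/ne/Cantor_Bernstein => //.
  rewrite (card_le_eql (card_setT _)); apply: card_le_segments => x [n xn] Ax.
  by apply: nA; exists n; apply: card_le_trans xn.
have nle : ~ ([set: omega_omega] #<= A).
  by move=> /card_le_trans /(_ An) /omega_lt_omega_omega.
split; last by rewrite card_eq_le => /andP[_ /nle].
by case: (card_le_total A [set: omega_omega]).
Qed.

End Omega.

Lemma DeltaP (X : topologicalType) : [set: X] !=set0 ->
  [/\ open (Delta X), Delta X !=set0 &
    forall H : set X, open H -> H !=set0 -> Delta X #<= H].
Proof.
move=> X0; pose I := [set G : set X | open G /\ G !=set0].
have T0 : I [set: X] by split=> //; exact: openT.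
have [G Gmin] := @min_card I (fun G => set_type (val G)) (SigSub (mem_set T0)).
rewrite /Delta; set P := [set G | _]; suff : exists G, P G by apply: xgetPex.
have [Go G0] := set_valP G; exists (val G); split=> // H Ho H0.
have IH : I H by [].
have := Gmin (SigSub (mem_set IH)).
by rewrite (card_le_eql (card_setT _)) (card_le_eqr (card_setT _)).
Qed.

(* Main.v *)
(* Call an open set W resolvable at omega_n if some f : W -> omega_n has all
   its tails {f >= a} dense in W.  A maximal disjoint family shows that it is
   enough to find inside every non-empty open set an open set resolvable at
   omega_1.  An open set of minimal cardinality omega_n, n >= 1, is resolvable at
   omega_n by any injection into omega_n, since it is not covered by fewer
   points.  By c.c.c. one descends from omega_{m+2} to omega_{m+1}: an Ulam
   matrix yields omega_{m+1} non-empty open sets G_i such that, on a dense set,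
   each point lies in at most omega_m of them.  By c.c.c. the unions V_d of the
   G_i, i >= d, are eventually dense in one another, so mapping a point to a
   bound of the indices i with x in G_i resolves some V_d at omega_{m+1}. *)
Require Import Defs.
From mathcomp Require Import all_boot all_classical topology.
From mathcomp Require wochoice.

Set Implicit Arguments.
Unset Strict Implicit.
Unset Printing Implicit Defensive.

Local Open Scope classical_set_scope.
Local Open Scope card_scope.

(** * Well-orders and injections *)

Section WellOrderTheory.
Variables (T : eqType) (R : rel T).
Hypothesis R_wo : wochoice.well_order R.
Implicit Types (x y z : T) (S : set T).

Lemma well_order_chain : wochoice.wo_chain R (@predT T).
Proof. exact: wochoice.withinW R_wo. Qed.

Lemma well_order_total x y : R x y || R y x.
Proof. exact: wochoice.wo_chainW well_order_chain x y isT isT. Qed.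

Lemma well_order_anti x y : R x y -> R y x -> x = y.
Proof.
move=> xy yx; apply: (wochoice.wo_chain_antisymmetric well_order_chain) => //.
by rewrite xy.
Qed.

Lemma well_order_min S : S !=set0 -> exists2 z, S z & forall y, S y -> R z y.
Proof.
move=> [x Sx]; have [|z [[zS zmin] _]] := R_wo (A := fun x => `[< S x >]).
  by exists x; apply/asboolP.
by exists z => [|y Sy]; [exact/asboolP|apply: zmin; exact/asboolP].
Qed.

Lemma well_order_trans y x z : R x y -> R y z -> R x z.
Proof.
move=> xy yz; have [|w] := @well_order_min [set x; y; z].
  by exists x; left; left.
move=> [[]|] -> wmin; first by apply: wmin; right.
  by rewrite (well_order_anti xy) //; apply: wmin; left; left.
by rewrite -(well_order_anti yz) //; apply: wmin; left; right.
Qed.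

Lemma segmentPn x y : ~ initial_segment R y x <-> R y x.
Proof.
split=> [nxy|yx /andP[xy /eqP]]; last by apply; exact: well_order_anti.
case/orP: (well_order_total x y) => // xy.
have [<-|xNy] := eqVneq x y; first by have := well_order_total x x;
  rewrite orbb.
by case: nxy; apply/andP.
Qed.

Lemma segment_neq x y : x <> y ->
  initial_segment R y x \/ initial_segment R x y.
Proof.
by move=> /eqP nxy; case/orP: (well_order_total x y) => xy; [left|right];
  apply/andP; rewrite // eq_sym.
Qed.

Lemma segment_trans x y z :
  initial_segment R y x -> R y z -> initial_segment R z x.
Proof.
move=> /andP[xy xNy] yz; apply: contrapT => /segmentPn zx; move/eqP: xNy; apply.
apply: well_order_anti => //; exact: well_order_trans zx.
Qed.

End WellOrderTheory.

(* Choose an injection greedily along [R]: at each stage the values already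
   taken do not exhaust [U]. *)
Lemma card_le_greedy (T U : Type) (R : T -> T -> Prop) :
  well_founded R -> (forall t u, t <> u -> R t u \/ R u t) ->
  (forall t, ~ ([set: U] #<= [set u | R u t])) -> [set: T] #<= [set: U].
Proof.
move=> Rwf Rtot Rlt.
have new t (h : forall u, R u t -> U) : exists a, forall u r, h u r <> a.
  apply: contrapT => nnew; apply: (Rlt t).
  have pre a : exists u, exists r : R u t, h u r = a.
    apply: contrapT => na; apply: nnew; exists a => u r hu.
    by apply: na; exists u, r.
  have [p pP] := choice pre.
  apply: (injT_card_le (f := p)) => [a _|a b _ _]; first by have [] := pP a.
  have [ra ha] := pP a; have [rb hb] := pP b => pab.
  rewrite -ha -hb; move: ra rb {ha hb}; rewrite pab => ra rb.
  by rewrite (Prop_irrelevance ra rb).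
pose F t h := sval (cid (@new t h)).
pose g := Fix Rwf (fun=> U) F.
have gE t : g t = F t (fun u _ => g u).
  apply: Fix_eq => {}t h h' hh'; congr F.
  by apply: functional_extensionality_dep => u;
     apply: functional_extensionality_dep => r.
have gN t u : R u t -> g u <> g t.
  by move=> ut; rewrite (gE t) /F; case: cid => /= a /(_ u ut).
apply: (injT_card_le (f := g)) => // t u _ _ gtu; apply: contrapT => /Rtot[] r.
  exact: gN r gtu.
by apply: (gN _ _ r).
Qed.

(** The default value [u] outside [A] makes the injection total, so that no membership proofs have
    to be carried. *)
Lemma card_le_fun (T U : Type) (A : set T) (B : set U) (u : U) :
  A #<= B -> exists f : T -> U, (forall x, A x -> B (f x)) /\
  (forall x y, A x -> A y -> f x = f y -> x = y).
Proof.
move=> /card_le_inj[f fI].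
exists (fun x => if pselect (x \in A) is left Ax then val (f (SigSub Ax)) else u).
split=> [x Ax|x y Ax Ay].
  by case: pselect => [?|/(_ (mem_set Ax))//]; exact: set_valP.
case: pselect => [Ax'|/(_ (mem_set Ax))//].
case: pselect => [Ay'|/(_ (mem_set Ay))//].
by move=> /val_inj /fI /(congr1 val).
Qed.

(** * Arithmetic and regularity of the cardinals omega_n *)

Section OmegaTheory.
Implicit Types (n m : nat).

Lemma omega_nat n : [set: nat] #<= [set: omega n].
Proof. by elim: n => // n IH; apply: card_le_trans (omega_leS n). Qed.

Lemma omega_inhabited n : exists a : omega n, True.
Proof.
have /card_le_inj[f _] := omega_nat n.
by exists (val (f (SigSub (mem_set (I : [set: nat] 0))))).
Qed.

Lemma omega_countable n (U : Type) (A : set U) : countable A -> A #<= [set: omega n].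
Proof. by move=> /card_le_trans; apply; exact: omega_nat. Qed.

(** A point of the union is coded by the code of an index and its own code in that [F i]. The bound
    on the square is a hypothesis because the induction proving it uses this lemma. *)
Lemma bigcup_card_le_square m (I U : Type) (D : set I) (F : I -> set U) :
  [set: omega m * omega m] #<= [set: omega m] ->
  D #<= [set: omega m] -> (forall i, D i -> F i #<= [set: omega m]) ->
  \bigcup_(i in D) F i #<= [set: omega m].
Proof.
have [a0 _] := omega_inhabited m.
move=> sq /(card_le_fun a0)[f [_ fI]] DF; apply: card_le_trans sq.
have /choice[g gI] i : exists g : U -> omega m,
    D i -> forall x y, F i x -> F i y -> g x = g y -> x = y.
  have [/DF/(card_le_fun a0)[g [_ gI]]|] := pselect (D i); first by exists g.
  by exists (fun=> a0).
have /choice[c cP] x : exists c, (\bigcup_(i in D) F i) x ->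
    exists i, [/\ D i, F i x & c = (f i, g i x)].
  have [[i Di Fx]|nx] := pselect ((\bigcup_(i in D) F i) x).
    by exists (f i, g i x) => _; exists i.
  by exists (a0, a0) => /nx.
apply: (injT_card_le (f := c)) => // x y /cP[i [Di Fx ->]] /cP[j [Dj Fy ->]].
by move=> [/(fI _ _ Di Dj) ij]; subst j; apply: gI.
Qed.

Definition omega_lt n (a b : omega n) := initial_segment (@omega_le n) b a.

Lemma omega_le_total n (a b : omega n) : omega_le a b || omega_le b a.
Proof. exact: well_order_total (@omega_wo n) _ _. Qed.

Lemma omega_le_refl n (a : omega n) : omega_le a a.
Proof. by have := omega_le_total a a; rewrite orbb. Qed.

Lemma omega_ltNge n (a b : omega n) : ~ omega_lt a b <-> omega_le b a.
Proof. exact: segmentPn (@omega_wo n) _ _. Qed.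

Lemma omegaS_le_segment_square m (a : omega m.+1) :
  [set: omega m * omega m] #<= [set: omega m] ->
  [set b | omega_le b a] #<= [set: omega m].
Proof.
move=> sq; apply: (card_le_trans (B := \bigcup_(i in [set: bool])
    (if i then initial_segment (@omega_le m.+1) a else [set a]))).
  apply: subset_card_le => b ba; have [->|bNa] := eqVneq b a.
    by exists false.
  by exists true => //; apply/andP.
apply: bigcup_card_le_square sq _ _; first exact/omega_countable/countableP.
by case=> _; [exact: omegaS_segment|exact/omega_countable/countable1].
Qed.

(* Pairs are ordered by their maximum, ties being broken arbitrarily; every
   proper initial segment then has at most omega_m elements. *)
Lemma omega_square m : [set: omega m * omega m] #<= [set: omega m].
Proof.
elim: m => [|m IH]; first exact: countableP.
pose mx (p : omega m.+1 * omega m.+1) := if omega_le p.1 p.2 then p.2 else p.1.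
have mxP p a : omega_le (mx p) a -> omega_le p.1 a /\ omega_le p.2 a.
  have tr := well_order_trans (@omega_wo m.+1).
  rewrite /mx; case: ifP => p12 pa; first by split=> //; exact: tr pa.
  by split=> //; apply: tr pa; move: (omega_le_total p.1 p.2); rewrite p12.
(* Both coordinates lie in a segment of size at most omega_m, whose square is bounded by
   induction. *)
have below a : [set p | omega_le (mx p) a] #<= [set: omega m].
  have [u0 _] := omega_inhabited m.
  have [f [_ fI]] := card_le_fun u0 (omegaS_le_segment_square a IH).
  apply: card_le_trans IH; apply: (injT_card_le (f := fun p => (f p.1, f p.2))) => //.
  by move=> [a1 a2] [b1 b2] /mxP[/= p1 p2] /mxP[/= q1 q2] [/fI-> // /fI-> //].
pose R p q := omega_lt (mx p) (mx q) \/
  mx p = mx q /\ initial_segment (@wo_le _) q p.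
apply: (card_le_greedy (R := R)).
- move=> p; apply: contrapT => np.
  have [_ [q nq <-] qmin] := @well_order_min _ _ (@omega_wo m.+1)
    (mx @` [set p | ~ Acc R p]) (ex_intro _ _ (ex_intro2 _ _ p np erefl)).
  have [r [nr rq] rmin] := @wo_min _ [set r | ~ Acc R r /\ mx r = mx q]
    (ex_intro _ q (conj nq erefl)).
  apply: nr; constructor => s; rewrite /R rq => sr; apply: contrapT => ns.
  case: sr => [|[sq /andP[sr /eqP]]].
    by apply/omega_ltNge/qmin; exists s.
  by apply; apply: wo_le_anti => //; apply: rmin.
- move=> p q pq; have [e|/(segment_neq (@omega_wo m.+1))[]] := EM (mx p = mx q).
  + by case: (segment_neq (@wo_leP _) pq) => ?; [left|right]; right.
  + by left; left.
  + by right; left.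
- move=> p le_p; apply: (@omegaS_gt m); apply: card_le_trans le_p _.
  apply: card_le_trans (below (mx p)); apply: subset_card_le => q.
  by move=> [/andP[]//|[qp _]]; rewrite /= qp; exact: (@omega_le_refl m.+1).
Qed.

Lemma bigcup_card_le m (I U : Type) (D : set I) (F : I -> set U) :
  D #<= [set: omega m] -> (forall i, D i -> F i #<= [set: omega m]) ->
  \bigcup_(i in D) F i #<= [set: omega m].
Proof. exact/bigcup_card_le_square/omega_square. Qed.

Lemma omegaS_le_segment m (a : omega m.+1) :
  [set b | omega_le b a] #<= [set: omega m].
Proof. exact/omegaS_le_segment_square/omega_square. Qed.

(** Regularity of omega_{m+1}: an unbounded [A] would cover it by omega_m segments of size at most
    omega_m. *)
Lemma omegaS_bounded m (A : set (omega m.+1)) : A #<= [set: omega m] ->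
  exists b, forall a, A a -> omega_lt a b.
Proof.
move=> Am; apply: contrapT => nb; apply: (@omegaS_gt m).
apply: (card_le_trans (B := \bigcup_(a in A) [set b | omega_le b a])).
  apply: subset_card_le => b _; apply: contrapT => nA; apply: nb; exists b => a Aa.
  by apply: contrapT => /omega_ltNge ba; apply: nA; exists a.
by apply: bigcup_card_le => // a _; exact: omegaS_le_segment.
Qed.

End OmegaTheory.

(** * Resolvable open sets and the descent to omega_1 *)

Definition resolvable_in (X : topologicalType) n (W : set X) : Prop :=
  exists f : X -> omega n, forall a (G : set X),
    open G -> G !=set0 -> G `<=` W -> exists2 x, G x & omega_le a (f x).

(** A non-empty [H] disjoint from all members is not itself a member, so adding it would contradict
    maximality. *)
Lemma maximal_disjoint_meets (X : Type) (P : set (set X)) :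
  exists F : set (set X), [/\ F `<=` P, trivIset F id &
    forall H, P H -> H !=set0 -> exists2 M, F M & (H `&` M) !=set0].
Proof.
have [F [FP Ftriv Fmax]] := ex_maximal_disjoint_subcollection id P.
exists F; split=> // H PH [x Hx]; apply: contrapT => nmeet.
have meetP M : F M -> H `&` M !=set0 -> False.
  by move=> FM HM; apply: nmeet; exists M.
apply: (Fmax (F `|` [set H])).
- split=> [M FM|sub]; first by left.
  by apply: (meetP H); [apply: sub; right|exists x].
- by move=> M [/FP|->].
- move=> M N [FM|->] [FN|->] //= MN; first exact: Ftriv.
  + by case: (meetP M FM); rewrite setIC.
  + by case: (meetP N FN).
Qed.

(** A maximal disjoint family of open sets [M], each missing some [V (d M)], is countable, so some
    [b] bounds all [d M]. An open subset of [V b] missing a later [V c] would meet some [M] inside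
    [V (d M)]. *)
Lemma ccc_stabilizes (X : topologicalType) m (V : omega m.+1 -> set X) :
  ccc X -> (forall d, open (V d)) ->
  (forall c d, omega_le c d -> V d `<=` V c) ->
  exists d0, forall d (G : set X), open G -> G !=set0 -> G `<=` V d0 ->
    G `&` V d !=set0.
Proof.
move=> cX Vo Vdecr.
pose P H := [/\ open H, H !=set0 & exists d, ~ (H `&` V d !=set0)].
have [F [FP Ftriv Fmax]] := maximal_disjoint_meets P.
have [a0 _] := omega_inhabited m.+1.
have /choice[d dP] H : exists d, P H -> ~ (H `&` V d !=set0).
  by have [[_ _ [d dH]]|] := pselect (P H); [exists d|exists a0].
have [|b bP] := @omegaS_bounded m (d @` F).
  apply: card_le_trans (card_image_le _ _) (omega_countable _ _).
  by apply: cX => // U /FP[].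
exists b => c G Go G0 GV; apply: contrapT => GVc.
have [|//|M FM [x [Gx Mx]]] := Fmax G; first by split=> //; exists c.
apply: (dP M (FP _ FM)); exists x; split=> //.
have /andP[dMb _] : omega_lt (d M) b by apply: bP; exists M.
exact: Vdecr dMb _ (GV _ Gx).
Qed.

(* If [W] itself does not work, the Ulam matrix [e y a] (a < y) produces sets
   [G a] such that [x \in G a] forces [e (f x) a < eta a]. As each [e y] is
   injective, any omega_{m+1} of the [G a] with the same [eta a] form a family
   in which every [x] with large [f x] has at most omega_m members. *)
Lemma resolvable_in_descent (X : topologicalType) m (W : set X) :
  ccc X -> open W -> W !=set0 -> resolvable_in m.+2 W ->
  exists W', [/\ open W', W' !=set0, W' `<=` W & resolvable_in m.+1 W'].
Proof.
move=> cX Wo W0 [f fW].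
have [|nres] := pselect (resolvable_in m.+1 W); first by exists W; split.
have [c0 _] := omega_inhabited m.+1; have [a0 _] := omega_inhabited m.+2.
have /choice[e eI] (y : omega m.+2) : exists e : omega m.+2 -> omega m.+1,
    forall a b, omega_lt a y -> omega_lt b y -> e a = e b -> a = b.
  by have [e [_ eI]] := card_le_fun c0 (omegaS_segment y);
    exists e => a b; exact: eI.
(* If no such pair existed, [fun x => e (f x) a] would resolve [W] at omega_{m+1}. *)
have /choice[p pP] (a : omega m.+2) : exists p : omega m.+1 * set X,
    [/\ open p.2, p.2 !=set0, p.2 `<=` W &
      forall x, p.2 x -> omega_lt a (f x) -> omega_lt (e (f x) a) p.1].
  apply: contrapT => np; apply: nres; exists (fun x => e (f x) a) => c G Go G0 GW.
  apply: contrapT => nG; apply: np; exists (c, G); split=> //= x Gx _.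
  by apply: contrapT => /omega_ltNge cx; apply: nG; exists x.
pose eta a := (p a).1; pose G a := (p a).2.
(* Pigeonhole: omega_{m+2} is not a union of omega_{m+1} sets of size at most omega_{m+1}. *)
have [c nc] : exists c, ~ ([set a | eta a = c] #<= [set: omega m.+1]).
  apply: contrapT => nc; apply: (@omegaS_gt m.+1).
  apply: (card_le_trans (B := \bigcup_c [set a | eta a = c])).
    by apply: subset_card_le => a _; exists (eta a).
  by apply: bigcup_card_le => // c _; apply: contrapT => cN; apply: nc; exists c.
have [//|/(card_le_fun a0)[s [sc sI]]] :=
  card_le_total [set a | eta a = c] [set: omega m.+1].
(* Once [f x] is at least [gam], every [s i] lies below [f x], where [e (f x)] is injective. *)
have [|gam gamP] := @omegaS_bounded m.+1 (range s); first exact: card_image_le.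
pose V d := \bigcup_(i in [set i | omega_le d i]) G (s i).
have Go i : open (G (s i)) by have [] := pP (s i).
have tr := well_order_trans (@omega_wo m.+1).
have Vo d : open (V d) by apply: bigcup_open => i _.
have [|d0 Vd0] := ccc_stabilizes cX Vo.
  by move=> d d' dd' x [i /= di Gx]; exists i => //=; exact: tr di.
have VW d : V d `<=` W by move=> x [i _]; have [_ _ + _] := pP (s i); apply.
exists (V d0); split=> //.
  have [_ [x Gx] _ _] := pP (s d0); exists x, d0 => //; exact: omega_le_refl.
(* The indices [i] with [x] in [G (s i)] inject into the segment below [c] by [e (f x) (s i)], hence
   are bounded; for other [x] the value [c] is arbitrary. *)
have /choice[b bP] x : exists b : omega m.+1, omega_le gam (f x) ->
    forall i, G (s i) x -> omega_lt i b.
  have [gx|] := pselect (omega_le gam (f x)); last by exists c.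
  have sx i : omega_lt (s i) (f x).
    by apply: (segment_trans (@omega_wo m.+2) _ gx); apply: gamP; exists i.
  have [|b bP] := @omegaS_bounded m [set i | G (s i) x]; last by exists b.
  apply: card_le_trans (omegaS_segment c).
  apply: (injT_card_le (f := fun i => e (f x) (s i))) => [i Gx|i j _ _].
    by have [_ _ _ /(_ x Gx (sx i))] := pP (s i); rewrite -/(eta _) sc.
  by move=> /(eI _ _ _ (sx i) (sx j)) /sI; apply.
exists b => d H Ho H0 HV.
(* [V d] meets [H] by the choice of [d0]; a point found there lies in some [G (s i)] with [i] at
   least [d], so [b x] exceeds [d]. *)
have [|||x [Hx [i /= di Gx]] gx] := fW gam (H `&` V d).
- exact: openI.
- exact: Vd0.
- by move=> y [_ /VW].
exists x => //; have /andP[ib _] := bP x gx i Gx; exact: tr ib.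
Qed.

Lemma resolvable_in_omega1 (X : topologicalType) n (W : set X) :
  ccc X -> open W -> W !=set0 -> resolvable_in n.+1 W ->
  exists W', [/\ open W', W' !=set0, W' `<=` W & resolvable_in 1 W'].
Proof.
move=> cX; elim: n W => [|n IH] W Wo W0 resW; first by exists W; split.
have [W1 [W1o W10 W1W /IH]] := resolvable_in_descent cX Wo W0 resW.
by move=> [//|//|W2 [W2o W20 W21 res2]]; exists W2; split=> // x /W21/W1W.
Qed.

(** * Open sets of minimal cardinality and gluing *)

Lemma min_card_open (X : topologicalType) (U : set X) : open U -> U !=set0 ->
  exists W, [/\ open W, W !=set0, W `<=` U &
    forall G, open G -> G !=set0 -> G `<=` W -> W #<= G].
Proof.
move=> Uo U0; pose I := [set G : set X | [/\ open G, G !=set0 & G `<=` U]].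
have IU : I U by split.
have [W Wmin] := @min_card I (fun G => set_type (val G)) (SigSub (mem_set IU)).
have [Wo W0 WU] := set_valP W; exists (val W); split=> // G Go G0 GW.
have IG : I G by split=> // x /GW/WU.
have := Wmin (SigSub (mem_set IG)).
by rewrite (card_le_eql (card_setT _)) (card_le_eqr (card_setT _)).
Qed.

(** Let omega_{m+1} be the least bound for [W]. If a tail of an injection into it missed an open
    [G], then [G] would inject into a proper segment, and [W], no larger than [G], would fit into
    omega_m. *)
Lemma resolvable_in_min_card (X : topologicalType) n (W : set X) :
  W #<= [set: omega n] -> ~ (W #<= [set: omega 0]) ->
  (forall G, open G -> G !=set0 -> G `<=` W -> W #<= G) ->
  exists m, resolvable_in m.+1 W.
Proof.
move=> Wn W0 Wmin.
have ex : exists k, `[< W #<= [set: omega k] >] by exists n; apply/asboolP.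
case: (ex_minnP ex) => -[/asboolP//|m] /asboolP Wm mmin; exists m.
have [a0 _] := omega_inhabited m.+1.
have [f [_ fI]] := card_le_fun a0 Wm.
exists f => a G Go G0 GW; apply: contrapT => nG.
suff Wm1 : W #<= [set: omega m] by have := mmin _ (asboolT Wm1); rewrite ltnn.
apply: card_le_trans (Wmin G Go G0 GW) _; apply: card_le_trans (omegaS_segment a).
apply: (injT_card_le (f := f)) => [x Gx|x y /GW Wx /GW Wy]; last exact: fI.
by apply: contrapT => /omega_ltNge ax; apply: nG; exists x.
Qed.

(** The resolving functions are glued along a maximal disjoint family of resolvable open sets. *)
Lemma resolvable_of_pi_base (X : topologicalType) :
  (forall U : set X, open U -> U !=set0 ->
    exists W, [/\ open W, W !=set0, W `<=` U & resolvable_in 1 W]) ->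
  monotonically_omega1_resolvable X.
Proof.
move=> Xres; have [a0 _] := omega_inhabited 1.
have [F [FP Ftriv Fmax]] :=
  maximal_disjoint_meets [set W : set X | open W /\ resolvable_in 1 W].
have /choice[g gP] (M : set X) : exists g : X -> omega 1, F M ->
    forall a G, open G -> G !=set0 -> G `<=` M -> exists2 x, G x & omega_le a (g x).
  by have [/FP[_ [g gM]]|] := pselect (F M); [exists g|exists (fun=> a0)].
(* [M x] is the unique member containing [x], with default [set0] if there is none. *)
have /choice[M MP] x : exists M : set X, forall N, F N -> N x -> M = N.
  have [[M [FM Mx]]|nM] := pselect (exists M, F M /\ M x); last first.
    by exists set0 => N FN Nx; case: nM; exists N.
  by exists M => N FN Nx; apply: Ftriv => //; exists x.
exists (fun x => g (M x) x) => a O O0 Oo.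
have [W [Wo W0 WO resW]] := Xres O Oo O0.
have [//|//|N FN WN] := Fmax W; have [No _] := FP _ FN.
have [||x [Wx Nx] ax] := gP N FN a (W `&` N) _ WN; first exact: openI.
  exact: subIsetr.
by exists x; split; [exact: WO|rewrite /= (MP x N)].
Qed.

Theorem theorem1p3 (X : topologicalType) :
  ccc X ->
  [set: omega 1] #<= Delta X ->
  Delta X #<= [set: X] ->
  card_lt [set: X] [set: omega_omega] ->
  monotonically_omega1_resolvable X.
Proof.
move=> cX leDelta _ /card_lt_omega_omegaP[n Xn].
apply: resolvable_of_pi_base => U Uo U0.
have [W [Wo W0 WU Wmin]] := min_card_open Uo U0.
have [||m resW] := @resolvable_in_min_card X n W _ _ Wmin.
- exact: card_le_trans (card_leT _) Xn.
(* A countable [W] would make omega_1 countable through Delta(X). *)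
- move=> W_0; apply: (@omegaS_gt 0); apply: card_le_trans W_0.
  apply: card_le_trans leDelta _; have [x _] := U0.
  by have [|_ _] := @DeltaP X; [exists x|apply].
- have [W' [W'o W'0 W'W res']] := resolvable_in_omega1 cX Wo W0 resW.
  by exists W'; split=> // x /W'W/WU.
Qed.
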